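(* Let $n>1$ and let $(X_j)_{j\ge1}$ be independent and identically distributed random variables on a probability space $(\Omega,\mathcal{F},\mathbb{P})$ with values in $\{a_1,a_2,\dots,a_n\}\subseteq K_n$. Put $p_i=\mathbb{P}(X_1=a_i)$ and assume $p_i>0$ for all $i=1,2,\dots,n$. Let $P_0=e$, $P_j=X_1X_2\cdots X_j$ (product in $K_n$) for $j\ge1$, and let $T=\inf\{j\ge0\mid P_j=f\}$. Then $T$ is distributed as a sum of $n$ independent geometric random variables with success probabilities $p_1,p_2,\dots,p_n$.
   Context: Kiselman's semigroup $K_n$ is the monoid, with unit element $e$, given by generators $a_1,\dots,a_n$ and relations $a_i^2=a_i$ for all $1\le i\le n$, and $a_i a_j a_i = a_j a_i a_j = a_i a_j$ for all $1\le j<i\le n$. The element $f=a_na_{n-1}\cdots a_1$ is the zero element of $K_n$, i.e. $fx=xf=f$ for all $x\in K_n$. A geometric random variable $V$ with success probability $p$ takes values in $\{1,2,3,\dots\}$ with $\mathbb{P}(V=k)=(1-p)^{k-1}p$. The convention $\inf\emptyset=\infty$ is used. *)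

(* Defs.v *)
From HB Require Import structures.
From mathcomp Require Import all_boot all_order fingroup all_algebra finmap.
From mathcomp Require Import all_classical all_reals all_analysis.
From mathcomp Require Import measurable_realfun.

Set Implicit Arguments.
Unset Strict Implicit.
Unset Printing Implicit Defensive.

Import Order.TTheory GRing.Theory Num.Theory.
Local Open Scope classical_set_scope.
Local Open Scope ring_scope.

(* Kiselman's semigroup, given by its presentation: words over 'I_n modulo the
   congruence generated by the relators. The ordinal i stands for the generator
   a_{i+1}. *)
Section Kiselman.
Variable n : nat.

Inductive kiselman_relator : seq 'I_n -> seq 'I_n -> Prop :=
| kiselman_idem (i : 'I_n) : kiselman_relator [:: i; i] [:: i]
| kiselman_absr (i j : 'I_n) : (j < i)%N -> kiselman_relator [:: i; j; i] [:: i; j]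
| kiselman_absl (i j : 'I_n) : (j < i)%N -> kiselman_relator [:: j; i; j] [:: i; j].

Inductive kiselman_congr : seq 'I_n -> seq 'I_n -> Prop :=
| kcongr_relator u v : kiselman_relator u v -> kiselman_congr u v
| kcongr_refl u : kiselman_congr u u
| kcongr_sym u v : kiselman_congr u v -> kiselman_congr v u
| kcongr_trans u v w :
    kiselman_congr u v -> kiselman_congr v w -> kiselman_congr u w
| kcongr_cat u u' v v' :
    kiselman_congr u u' -> kiselman_congr v v' ->
    kiselman_congr (u ++ v) (u' ++ v').

Definition kiselman_rel : rel (seq 'I_n) :=
  fun u v => `[< kiselman_congr u v >].

Fact kiselman_rel_refl : reflexive kiselman_rel.
Proof. by move=> u; apply/asboolP; exact: kcongr_refl. Qed.

Fact kiselman_rel_sym : symmetric kiselman_rel.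
Proof.
by move=> u v; apply/idP/idP => /asboolP uv; apply/asboolP; exact: kcongr_sym.
Qed.

Fact kiselman_rel_trans : transitive kiselman_rel.
Proof.
move=> v u w /asboolP uv /asboolP vw; apply/asboolP.
exact: kcongr_trans uv vw.
Qed.

Canonical kiselman_equiv :=
  EquivRel kiselman_rel kiselman_rel_refl kiselman_rel_sym kiselman_rel_trans.

Local Open Scope quotient_scope.

Definition kiselman := {eq_quot kiselman_equiv}.

HB.instance Definition _ := Choice.copy kiselman {eq_quot kiselman_equiv}.

Definition kiselman_class (u : seq 'I_n) : kiselman :=
  \pi_({eq_quot kiselman_equiv}) u.

Definition kiselman_repr (x : kiselman) : seq 'I_n :=
  generic_quotient.repr (x : {eq_quot kiselman_equiv}).

Lemma kiselman_reprK : cancel kiselman_repr kiselman_class.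
Proof. by move=> x; rewrite /kiselman_class reprK. Qed.

Lemma kiselman_classP u v :
  kiselman_class u = kiselman_class v <-> kiselman_congr u v.
Proof.
split=> [/eqmodP/asboolP//|uv].
by apply/eqmodP/asboolP.
Qed.

Definition kiselman_one : kiselman := kiselman_class [::].

Definition kiselman_mul (x y : kiselman) : kiselman :=
  kiselman_class (kiselman_repr x ++ kiselman_repr y).

Lemma kiselman_mul_class u v :
  kiselman_mul (kiselman_class u) (kiselman_class v) = kiselman_class (u ++ v).
Proof.
by apply/kiselman_classP/kcongr_cat; apply/kiselman_classP;
  rewrite kiselman_reprK.
Qed.

Fact kiselman_mulA : associative kiselman_mul.
Proof.
move=> x y z; rewrite -(kiselman_reprK x) -(kiselman_reprK y).
by rewrite -(kiselman_reprK z) !kiselman_mul_class catA.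
Qed.

Fact kiselman_mul1 : left_id kiselman_one kiselman_mul.
Proof. by move=> x; rewrite -(kiselman_reprK x) kiselman_mul_class. Qed.

Fact kiselman_1mul : right_id kiselman_one kiselman_mul.
Proof. by move=> x; rewrite -(kiselman_reprK x) kiselman_mul_class cats0. Qed.

HB.instance Definition _ :=
  isMonoid.Build kiselman kiselman_mulA kiselman_mul1 kiselman_1mul.

HB.instance Definition _ := isPointed.Build kiselman kiselman_one.

HB.instance Definition _ := @isMeasurable.Build default_measure_display
  kiselman discrete_measurable discrete_measurable0
  discrete_measurableC discrete_measurableU.

Definition kiselman_gen (i : 'I_n) : kiselman := kiselman_class [:: i].

Lemma kiselman_class_cat u v :
  (kiselman_class u * kiselman_class v)%g = kiselman_class (u ++ v).
Proof. exact: kiselman_mul_class. Qed.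

Lemma kiselman_gen_idem i :
  (kiselman_gen i * kiselman_gen i = kiselman_gen i)%g.
Proof.
rewrite kiselman_class_cat; apply/kiselman_classP/kcongr_relator.
exact: kiselman_idem.
Qed.

Lemma kiselman_gen_absr (i j : 'I_n) : (j < i)%N ->
  (kiselman_gen i * kiselman_gen j * kiselman_gen i =
   kiselman_gen i * kiselman_gen j)%g.
Proof.
move=> ji; rewrite (kiselman_class_cat [:: i]) kiselman_class_cat.
by apply/kiselman_classP/kcongr_relator; exact: (kiselman_absr ji).
Qed.

Lemma kiselman_gen_absl (i j : 'I_n) : (j < i)%N ->
  (kiselman_gen j * kiselman_gen i * kiselman_gen j =
   kiselman_gen i * kiselman_gen j)%g.
Proof.
move=> ji; rewrite (kiselman_class_cat [:: j]) (kiselman_class_cat [:: i]).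
rewrite kiselman_class_cat.
by apply/kiselman_classP/kcongr_relator; exact: (kiselman_absl ji).
Qed.

(* the product a_n a_{n-1} ... a_1 *)
Definition kiselman_zero : kiselman :=
  (\prod_(i < n) kiselman_gen (rev_ord i))%g.

End Kiselman.

Section Probability.
Local Open Scope ereal_scope.

Definition mutually_independent (R : realType) (d d' : measure_display)
    (Omega : measurableType d) (E : measurableType d')
    (P : probability Omega R) (I : choiceType) (X : I -> {RV P >-> E}) :=
  forall (J : {fset I}) (B : I -> set E),
    (forall i, i \in J -> measurable (B i)) ->
    P (\bigcap_(i in [set` J]) (X i @^-1` B i)) =
    \prod_(i <- J) P (X i @^-1` B i).

Definition identically_distributed (R : realType) (d d' : measure_display)
    (Omega : measurableType d) (E : measurableType d')
    (P : probability Omega R) (I : Type) (X : I -> {RV P >-> E}) :=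
  forall (i j : I) (B : set E), measurable B ->
    distribution P (X i) B = distribution P (X j) B.

Definition geometric_RV (R : realType) (d : measure_display)
    (Omega : measurableType d) (P : probability Omega R)
    (V : {RV P >-> nat}) (p : R) :=
  (forall w, (0 < V w)%N) /\
  forall k : nat, (0 < k)%N ->
    P [set w | V w = k] = ((1 - p) ^+ k.-1 * p)%:E.

End Probability.

Section Walk.
Variables (n : nat) (Omega : Type) (X : nat -> Omega -> kiselman n).

(* The sequence is indexed from 0: X k is the (k+1)-st step, so that
   kiselman_walk j w is the product of the first j steps. *)
Definition kiselman_walk (j : nat) (w : Omega) : kiselman n :=
  (\prod_(k < j) X k w)%g.

Definition hitting_time (R : realType) (w : Omega) : \bar R :=
  ereal_inf [set (j%:R)%:E | j in
    [set j : nat | kiselman_walk j w = kiselman_zero n]].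

End Walk.

(* Main.v *)
(* A word over the generators represents f iff it contains a_n, ..., a_2, a_1
   as a subsequence, in this order: the relations preserve the set of strictly
   decreasing subsequences, and conversely a word containing that subsequence
   can be reduced to a_n ... a_1 because a_i u a_i = a_i u when the letters of u
   are below a_i, and a_i u a_i = u a_i when they are above it. Hence T is
   obtained by waiting for a_n, then for a_(n-1), and so on, down to a_1; off a
   null set the law of these n waiting times is read off cylinder events, which
   gives independent geometric variables on the original probability space. *)

Require Import Defs.
From HB Require Import structures.
From mathcomp Require Import all_boot all_order fingroup all_algebra finmap.
From mathcomp Require Import all_classical all_reals all_analysis.
From mathcomp Require Import measurable_realfun.

Set Implicit Arguments.
Unset Strict Implicit.
Unset Printing Implicit Defensive.

Import Order.TTheory GRing.Theory Num.Theory.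
Import numFieldNormedType.Exports.
Local Open Scope classical_set_scope.
Local Open Scope ring_scope.

(** * Greedy search for a subsequence of a word *)

Section GreedyReader.
Context {T : eqType}.
Implicit Types (a b : T) (s u v : seq T).

(* One step of the greedy search for s as a subsequence: the state is the part
   of s that has not been found yet. *)
Definition read_letter s b :=
  if s is a :: s' then if a == b then s' else s else [::].

Lemma read_nil u : foldl read_letter [::] u = [::].
Proof. by elim: u. Qed.

Lemma read_suffix s u : exists s', s = s' ++ foldl read_letter s u.
Proof.
elim: u s => [|b u IH] [|a s] /=; try by exists [::]; rewrite ?read_nil.
case: eqP => _; last exact: IH.
by have [r {1}->] := IH s; exists (a :: r).
Qed.

(** A letter outside [s] never advances the search, and what remains of [s] stays free of it. *)
Lemma read_filter a s u : a \notin s ->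
  foldl read_letter s [seq b <- u | b != a] = foldl read_letter s u.
Proof.
elim: u s => [|b u IH] s //= as_.
have as' : a \notin read_letter s b.
  case: s as_ => [|x s] //=; rewrite inE negb_or => /andP[ax as_].
  by case: (x == b); rewrite // inE negb_or ax.
have [ba|_] := eqVneq b a; last by rewrite /= IH.
rewrite /= IH //; congr foldl.
case: s as_ {as'} => [|x s] //=.
by rewrite inE ba negb_or eq_sym => /andP[/negPf->].
Qed.

(** The letter [a] is looked for last, so [u] can be cut at an occurrence of [a] before which all of
    [s] has been found. *)
Lemma read_rcons_split s a u : foldl read_letter (rcons s a) u = [::] ->
  exists v w, u = v ++ a :: w /\ foldl read_letter s v = [::].
Proof.
elim: u s => [|b u IH] [|x s] //=.
  case: eqP => [<- _|_ h]; first by exists [::], u.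
  have [v [w [-> _]]] := IH [::] h.
  by exists (b :: v), w; rewrite /= read_nil.
case: eqP => [xb|xb] h.
  have [v [w [-> hv]]] := IH s h.
  by exists (b :: v), w; split=> //=; rewrite xb eqxx.
have [v [w [-> hv]]] := IH (x :: s) h.
by exists (b :: v), w; split=> //=; move/eqP/negPf: xb => ->.
Qed.

End GreedyReader.

(** * Words representing the zero element *)

Section KiselmanZero.
Variable n : nat.
Implicit Types (i j : 'I_n) (c u v : seq 'I_n).

Let gto : rel 'I_n := fun i j => (j < i)%N.

Let gto_trans : transitive gto.
Proof. by move=> j i k ij jk; exact: ltn_trans jk ij. Qed.

(** Both sides of each relator contain the same letters; this invariant separates the generators. *)
Lemma kiselman_congr_mem u v : kiselman_congr u v -> u =i v.
Proof.
elim=> {u v} [_ _ [i|i j _|i j _]|//|u v _ IH|u v w _ IH _ IH'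
  |u u' v v' _ IH _ IH'] x; rewrite ?inE.
- by case: (x == i).
- by case: (x == i); case: (x == j).
- by case: (x == i); case: (x == j).
- by rewrite IH.
- by rewrite IH IH'.
- by rewrite !mem_cat IH IH'.
Qed.

Lemma kiselman_gen_inj : injective (@kiselman_gen n).
Proof.
move=> i j /kiselman_classP /kiselman_congr_mem /(_ i).
by rewrite !inE eqxx => /esym/eqP.
Qed.

(** In a decreasing [c], once a letter is found only smaller ones are sought, so the extra letter on
    the longer side of a relator leaves the final state unchanged. *)
Lemma read_congr c u v : kiselman_congr u v -> sorted gto c ->
  foldl read_letter c u = foldl read_letter c v.
Proof.
move=> uv; elim: uv c => {u v}
  [_ _ [i|i j ji|i j ji]|//|u v _ IH c /IH//|u v w _ IH _ IH' c cs
  |u u' v v' _ IH _ IH' c cs].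
- case=> [|x s] //=; have [->|/negPf xi] := eqVneq x i; last by rewrite /= xi.
  case: s => [|y s] //= /andP[]; rewrite /gto => yi _.
  by rewrite -val_eqE ltn_eqF.
- have neq (k : 'I_n) : (k <= j)%N -> (k == i) = false.
    by move=> kj; rewrite -val_eqE ltn_eqF // (leq_ltn_trans kj).
  case=> [|x s] //= ss.
  (* After [j] has been read, a following [i] is idle unless [i] was already sought. The exception
     is excluded both for [s] behind a matched [i] and for [x :: s] with [x != i]. *)
  have key r : sorted gto r -> read_letter (read_letter r j) i = read_letter r j \/
      exists r', r = i :: r'.
    case: r => [|y r] //= yr; first by left.
    case: eqP => [yj|_] /=; last by case: eqP => [->|_]; [right; exists r|left].
    left; case: r yr => [|z r] //= /andP[]; rewrite /gto yj => zj _.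
    by rewrite neq // ltnW.
  case: ifPn => [/eqP xi|xi].
    case: (key s (path_sorted ss)) => // -[r' sE].
    by move: ss; rewrite sE xi /= /gto ltnn.
  case: (key (x :: s) ss) => // -[r' [xi' _]]; by rewrite xi' eqxx in xi.
- have neq (k : 'I_n) : (k <= j)%N -> (k == i) = false.
    by move=> kj; rewrite -val_eqE ltn_eqF // (leq_ltn_trans kj).
  case=> [|x s] //= ss; have [xj|//] := eqVneq x j.
  rewrite xj (neq j) //= eqxx.
  case: s ss => [|y s] //= /andP[]; rewrite /gto xj => yj _.
  by rewrite neq 1?ltnW //= -val_eqE ltn_eqF.
- by rewrite IH // IH'.
- rewrite !foldl_cat -IH //; apply: IH'.
  (* The second factor is read from the suffix of [c] left by the first, which is again
     decreasing. *)
  have [s' cE] := read_suffix c u.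
  by move: cs; rewrite {1}cE => /cat_sorted2[].
Qed.

Local Notation cls := (@kiselman_class n).
Local Notation gen := (@kiselman_gen n).
Local Open Scope group_scope.

Let cls_cons i u : cls (i :: u) = gen i * cls u.
Proof. by rewrite kiselman_class_cat. Qed.

(** By [kiselman_gen_absr] a copy of [gen i] can be inserted behind the first letter of [u]; it
    absorbs the last [gen i] by induction and is then removed. *)
Lemma kiselman_absorb_lower i u : all (fun j => (j < i)%N) u ->
  gen i * cls u * gen i = gen i * cls u.
Proof.
elim: u => [_|j u IH /= /andP[ji /IH uE]].
  by rewrite mulg1 kiselman_gen_idem.
by rewrite cls_cons mulgA -(kiselman_gen_absr ji) -!mulgA [in LHS]mulgA -!mulgA
  (mulgA (gen i) (cls u)) uE.
Qed.

(** Mirror image of the previous argument: [kiselman_gen_absl] inserts the copy before the last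
    letter of [u]. *)
Lemma kiselman_absorb_upper i u : all (fun j => (i < j)%N) u ->
  gen i * cls u * gen i = cls u * gen i.
Proof.
elim/last_ind: u => [_|u j IH]; first by rewrite mulg1 kiselman_gen_idem mul1g.
rewrite all_rcons => /andP[ij /IH uE].
rewrite -cats1 -kiselman_class_cat -/(gen j) -!mulgA -(kiselman_gen_absl ij).
by rewrite !mulgA uE.
Qed.

Lemma kiselman_drop_lowest i u : all (fun j => (i <= j)%N) u ->
  cls u * gen i = cls [seq j <- u | j != i] * gen i.
Proof.
elim: u => [//|j u IH] /= /andP[ij uall].
have [ji|ji] := eqVneq j i; last by rewrite /= !cls_cons -!mulgA IH.
rewrite /= ji cls_cons -mulgA IH // mulgA kiselman_absorb_upper //.
apply/allP => k; rewrite mem_filter => /andP[ki /(allP uall) ik].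
by rewrite ltn_neqAle eq_sym -val_eqE in ki *; rewrite ki.
Qed.

(** Behind [i] the decreasing word [c] has only letters below [i], so a further [i] is absorbed; the
    letters of [u] disappear one by one. *)
Lemma kiselman_absorb_sorted c u : sorted gto c -> {subset u <= c} ->
  cls c * cls u = cls c.
Proof.
move=> cs; elim: u => [_|i u IH uc]; first by rewrite mulg1.
rewrite cls_cons mulgA.
have ->: cls c * gen i = cls c; last first.
  by apply: IH => j ju; apply: uc; rewrite inE ju orbT.
have /path.splitPr cE := uc i (mem_head _ _).
case: cE cs => c1 c2 /cat_sorted2[_ /= ic2].
rewrite -kiselman_class_cat cls_cons -!mulgA mulgA -mulgA (mulgA (gen i)).
by rewrite kiselman_absorb_lower //; exact: order_path_min ic2.
Qed.

(** Induction removes the least letter [a] of the pattern. Cut [u] where [a] completes the search: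
    earlier copies of [a] are dropped, the remaining prefix reduces to [c] by induction, and the
    tail is absorbed. *)
Lemma class_read c u : sorted gto c ->
  (forall i j, i \in c -> (i < j)%N -> j \in c) -> {subset u <= c} ->
  foldl read_letter c u = [::] -> cls u = cls c.
Proof.
elim/last_ind: c u => [|c a IH] u cs cup uc.
  by case: u uc => // i u /(_ i (mem_head _ _)).
move=> /read_rcons_split[v [w [uE vread]]].
have ac : all (gto^~ a) c.
  move: cs; rewrite -cats1 sorted_pairwise // pairwise_cat /=.
  by rewrite allrel1r => /andP[].
have cs' : sorted gto c by move: cs; rewrite -cats1 => /cat_sorted2[].
have anc : a \notin c by apply/negP => /(allP ac); rewrite /gto ltnn.
have vc : {subset v <= rcons c a}.
  by move=> x xv; apply: uc; rewrite uE mem_cat xv.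
rewrite uE -kiselman_class_cat cls_cons mulgA kiselman_drop_lowest; last first.
  apply/allP => x /vc; rewrite mem_rcons inE => /orP[/eqP->//|/(allP ac)].
  exact: ltnW.
rewrite (IH [seq j <- v | j != a]) //; first last.
- by rewrite read_filter.
- move=> x; rewrite mem_filter => /andP[xa /vc].
  by rewrite mem_rcons inE (negPf xa).
- move=> i j ic ij; have := cup i j; rewrite !mem_rcons !inE ic orbT.
  move=> /(_ isT ij) /orP[/eqP ja|//].
  by have := allP ac _ ic; rewrite /gto -ja ltnNge ltnW.
have -> : cls c * gen a = cls (rcons c a) by rewrite kiselman_class_cat cats1.
rewrite kiselman_absorb_sorted // => x xw.
by apply: uc; rewrite uE mem_cat inE xw !orbT.
Qed.

Definition descending_letters : seq 'I_n := [seq rev_ord i | i <- enum 'I_n].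

Lemma mem_descending_letters i : i \in descending_letters.
Proof. by apply/mapP; exists (rev_ord i); rewrite ?mem_enum ?rev_ordK. Qed.

Lemma descending_letters_uniq : uniq descending_letters.
Proof. by rewrite map_inj_uniq ?enum_uniq //; exact: rev_ord_inj. Qed.

Lemma descending_letters_sorted : sorted gto descending_letters.
Proof.
have : sorted ltn [seq val i | i <- enum 'I_n] by rewrite val_enum_ord iota_ltn_sorted.
rewrite sorted_map /descending_letters sorted_map; apply: sub_sorted => i j /= ij.
by apply: ltn_sub2l => //; exact: leq_trans (ltn_ord j).
Qed.

Lemma prod_kiselman_gen u : \prod_(i <- u) gen i = cls u.
Proof.
elim: u => [|i u IH]; first by rewrite big_nil.
by rewrite big_cons IH cls_cons.
Qed.

Lemma kiselman_zeroE : kiselman_zero n = cls descending_letters.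
Proof.
by rewrite /kiselman_zero -prod_kiselman_gen big_map enumT [index_enum _]unlock.
Qed.

Lemma read_self c : foldl read_letter c c = [::].
Proof. by elim: c => [|i c] //=; rewrite eqxx. Qed.

Lemma class_zeroP u :
  cls u = kiselman_zero n <-> foldl read_letter descending_letters u = [::].
Proof.
rewrite kiselman_zeroE; split => [/kiselman_classP uc|].
  by rewrite (read_congr uc descending_letters_sorted) read_self.
apply: class_read => [|i j _ _|i _]; first exact: descending_letters_sorted.
all: exact: mem_descending_letters.
Qed.

End KiselmanZero.

(** * Waiting times along a deterministic sequence *)

Section WaitingTimes.
Context {T : eqType}.
Implicit Types (y : nat -> T) (a : T) (t k : nat) (c : seq T).

Definition recurrent y := forall t a, exists s, y (t + s)%N == a.

(* The junk value 1 is used when a does not occur from time t on. *)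
Definition waiting y t a : nat :=
  if pselect (exists s, y (t + s)%N == a) is left h then (ex_minn h).+1
  else 1%N.

Fixpoint waits y t c : seq nat :=
  if c is a :: c' then
    waiting y t a :: waits y (t + waiting y t a)%N c'
  else [::].

(** Cylinder events as lists of conditions on consecutive letters, a form in which independence
    turns into a product over the list. *)
Fixpoint matches y t (s : seq (pred T)) : bool :=
  if s is q :: s' then q (y t) && matches y t.+1 s' else true.

(** The pattern of a first occurrence of [a] at the [k]-th letter. For [k = 0] it coincides with the
    pattern for [k = 1], whence the positivity conditions below. *)
Definition first_at a k : seq (pred T) :=
  rcons (nseq k.-1 (predC1 a : pred T)) (pred1 a : pred T).

Definition waits_pattern c (ks : seq nat) : seq (pred T) :=
  flatten [seq first_at ak.1 ak.2 | ak <- zip c ks].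

Lemma waiting_gt0 y t a : (0 < waiting y t a)%N.
Proof. by rewrite /waiting; case: pselect. Qed.

Lemma size_waits y t c : size (waits y t c) = size c.
Proof. by elim: c t => //= a c IH t; rewrite IH. Qed.

Lemma waits_gt0 y t c : all (leq 1) (waits y t c).
Proof. by elim: c t => //= a c IH t; rewrite IH waiting_gt0. Qed.

Lemma waitingS y t a : (exists s, y (t + s)%N == a) ->
  waiting y t a = if y t == a then 1%N else (waiting y t.+1 a).+1.
Proof.
move=> yt; rewrite /waiting; case: pselect => // h.
case: ex_minnP => m ym mmin; case: ifPn => [yta|yta].
  by congr S; apply/eqP; rewrite -leqn0; apply: mmin; rewrite addn0.
case: m ym mmin => [|m] ym mmin; first by rewrite addn0 (negPf yta) in ym.
case: pselect => [h'|]; last by case; exists m; rewrite addSn -addnS.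
case: ex_minnP => m' ym' mmin'; congr S; apply/eqP; rewrite eqn_leq; apply/andP.
split; first by apply: mmin; rewrite addnS -addSn.
by rewrite ltnS; apply: mmin'; rewrite addSn -addnS.
Qed.

Lemma matches_cat y t s1 s2 :
  matches y t (s1 ++ s2) = matches y t s1 && matches y (t + size s1) s2.
Proof.
elim: s1 t => [|q s1 IH] t /=; first by rewrite addn0.
by rewrite IH andbA addnS.
Qed.

Lemma size_first_at a k : (0 < k)%N -> size (first_at a k) = k.
Proof. by case: k => // k _; rewrite size_rcons size_nseq. Qed.

Lemma waiting_matches y t a k : (exists s, y (t + s)%N == a) -> (0 < k)%N ->
  (waiting y t a == k) = matches y t (first_at a k).
Proof.
move=> + ; case: k => // k; elim: k t => [|k IH] t yt _; rewrite waitingS //=.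
  by rewrite andbT; case: (y t == a); rewrite // eqSS eqn0Ngt waiting_gt0.
have [//|yta] := eqVneq (y t) a; rewrite /= eqSS IH //.
case: yt => [[|s]]; first by rewrite addn0 (negPf yta).
by exists s; rewrite addSn -addnS.
Qed.

(** Prescribed waits fix the times at which the searches start, so the individual patterns can be
    concatenated. *)
Lemma waits_matches y t c ks : recurrent y -> size ks = size c ->
  all (leq 1) ks ->
  (waits y t c == ks) = matches y t (waits_pattern c ks).
Proof.
move=> yrec; elim: c ks t => [|a c IH] [|k ks] t //= [sz] /andP[k0 ks0].
rewrite /waits_pattern /= matches_cat -waiting_matches // size_first_at //.
by rewrite eqseq_cons; case: eqP => //= ->; exact: IH.
Qed.

(** Each new letter either ends the current wait or shortens it by one, exactly as it advances the
    reader or leaves it unchanged. *)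
Lemma read_waits y t c j : recurrent y ->
  (foldl read_letter c [seq y i | i <- iota t j] == [::]) =
  (sumn (waits y t c) <= j)%N.
Proof.
move=> yrec; elim: j t c => [|j IH] t [|a c] //=.
- by rewrite leqn0 addn_eq0 eqn0Ngt waiting_gt0.
- rewrite IH waitingS // [a == _]eq_sym; case: ifP => _ /=.
    by rewrite addn1.
  by rewrite addSn addnS -addSn.
Qed.

End WaitingTimes.

(** * Independence and marginals from a joint mass function *)

Section JointLaw.
Context d (Omega : measurableType d) (R : realType) (P : probability Omega R).

Lemma measure_eq_off_null (A B N : set Omega) : measurable A -> measurable B ->
  measurable N -> P N = 0%E -> (forall w, ~ N w -> A w <-> B w) -> P A = P B.
Proof.
move=> mA mB mN N0 AB; rewrite -(measureU0 mA mN) // -(measureU0 mB mN) //.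
congr (P _); apply/seteqP; split=> w [|]; try by right.
  by have [Nw|Nw] := pselect (N w); [right|move=> /(AB w Nw); left].
by have [Nw|Nw] := pselect (N w); [right|move=> /(AB w Nw); left].
Qed.

Context (I : finType) (V : I -> Omega -> nat) (g : I -> nat -> R).
Hypothesis mV : forall i (B : set nat), measurable (V i @^-1` B).
Hypothesis g_ge0 : forall i k, 0 <= g i k.
Hypothesis g_sum : forall i, (\sum_(k <oo) (g i k)%:E = 1)%E.
Hypothesis joint_pmf : forall k : I -> nat,
  P [set w | forall i, V i w = k i] = (\prod_i g i (k i))%:E.

Definition law_of (f : nat -> R) (B : set nat) : \bar R :=
  (\sum_(k <oo | k \in B) (f k)%:E)%E.

Lemma law_of_set1 i k : law_of (g i) [set k] = (g i k)%:E.
Proof.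
rewrite /law_of (@nneseriesD1 _ _ k); last 2 first.
- by move=> *; rewrite lee_fin.
- exact/mem_set.
rewrite eseries0 ?adde0 // => j _ /andP[/set_mem -> /eqP]; by [].
Qed.

Lemma law_of_setT i : law_of (g i) setT = 1%E.
Proof. by rewrite -(g_sum i); apply: eq_eseriesl => k; rewrite in_setT. Qed.

Lemma law_of_fin_num i B : law_of (g i) B \is a fin_num.
Proof.
rewrite ge0_fin_numE; last by apply: nneseries_ge0 => *; rewrite lee_fin.
apply: le_lt_trans (ltry 1); rewrite -(law_of_setT i).
by apply: subset_lee_nneseries => k; rewrite ?lee_fin // in_setT.
Qed.

Let mI (B : I -> set nat) : measurable [set w | forall i, B i (V i w)].
Proof.
have -> : [set w | forall i, B i (V i w)] = \bigcap_i (V i @^-1` B i).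
  by apply/seteqP; split=> w Bw i => [_|]; exact: Bw.
by apply: fin_bigcap_measurable => [|i _]; [exact: finite_finset|exact: mV].
Qed.

(* One enlarges the singletons of the joint mass function to arbitrary sets, one
   coordinate at a time. *)
Lemma joint_law (B : I -> set nat) :
  P [set w | forall i, B i (V i w)] = (\prod_i law_of (g i) (B i))%E.
Proof.
(* The list holds the coordinates whose sets are arbitrary. The full list imposes no condition; the
   empty one leaves only singletons, the case of [joint_pmf]. *)
have: forall i, i \notin enum I -> exists k, B i = [set k].
  by move=> i; rewrite mem_enum.
elim: (enum I) B => [|a s IH] B Bs.
  have /choice[k kB] i : exists k, B i = [set k] by apply: Bs.
  have -> : [set w | forall i, B i (V i w)] = [set w | forall i, V i w = k i].
    by apply: eq_set => w; apply: eq_forall => i; rewrite kB.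
  rewrite joint_pmf -prodEFin; apply: eq_bigr => i _.
  by rewrite kB law_of_set1.
pose Bj j i := if i == a then [set j] else B i.
have -> : [set w | forall i, B i (V i w)] =
    \bigcup_(j in B a) [set w | forall i, Bj j i (V i w)].
  apply/seteqP; split=> [w Bw|w [j Baj Bw] i].
    exists (V a w) => //= i; rewrite /Bj; case: eqP => [->//|_]; exact: Bw.
  by have := Bw i; rewrite /Bj; case: eqP => [-> /= ->|].
rewrite measure_bigcup //; last first.
  move=> j j' _ _ [w [/(_ a) + /(_ a)]].
  by rewrite /Bj eqxx => /= -> ->.
have Pj j : P [set w | forall i, Bj j i (V i w)] =
    ((\prod_(i | i != a) law_of (g i) (B i)) * (g a j)%:E)%E.
  rewrite IH; last first.
    move=> i is_; rewrite /Bj; case: eqP => [_|/eqP ia]; first by exists j.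
    by apply: Bs; rewrite inE negb_or ia.
  rewrite (bigD1 a) //= /Bj eqxx law_of_set1 muleC; congr (_ * _)%E.
  by apply: eq_bigr => i /negPf->.
rewrite (eq_eseriesr (fun j _ => Pj j)).
(* Finiteness lets the common factor be taken out of the series over the values of coordinate
   [a]. *)
have cfin : (\prod_(i | i != a) law_of (g i) (B i))%E \is a fin_num.
  by apply: prode_fin_num => i _; exact: law_of_fin_num.
rewrite -(fineK cfin) nneseriesZl; last by move=> *; rewrite lee_fin.
by rewrite fineK // [RHS](bigD1 a) //= muleC.
Qed.

Lemma marginal_law i B : P (V i @^-1` B) = law_of (g i) B.
Proof.
pose B' j := if j == i then B else setT.
have -> : V i @^-1` B = [set w | forall j, B' j (V j w)].
  apply/seteqP; split=> [w Bw j|w /(_ i)]; last by rewrite /B' eqxx.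
  by rewrite /B'; case: eqP => [->|].
rewrite joint_law (bigD1 i) //= /B' eqxx big1 ?mule1 // => j /negPf->.
exact: law_of_setT.
Qed.

Lemma joint_pmf_independent (W : I -> {RV P >-> nat}) :
  (forall i, W i = V i :> (Omega -> nat)) -> mutually_independent W.
Proof.
move=> WV J B _.
(* Coordinates outside [J] get the full set, of mass 1, so that [joint_law] over all coordinates
   applies. *)
pose B' i := if i \in J then B i else setT.
have -> : \bigcap_(i in [set` J]) (W i @^-1` B i) =
    [set w | forall i, B' i (V i w)].
  apply/seteqP; split=> [w Bw i|w Bw i /= iJ].
    by rewrite /B'; case: ifP => // iJ; have := Bw i iJ; rewrite /= WV.
  by have := Bw i; rewrite /B' iJ WV.
rewrite joint_law [in RHS]big_uniq ?fset_uniq // [in RHS]big_mkcond.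
apply: eq_bigr => i _; rewrite /B'; case: ifP => iJ; last by rewrite law_of_setT.
by rewrite -marginal_law WV.
Qed.

End JointLaw.

(** * Waiting times of independent, identically distributed letters *)

Section IIDLetters.
Context d (Omega : measurableType d) (R : realType) (P : probability Omega R).

Lemma measurable_bool_set (b : bool) : measurable [set _ : Omega | b].
Proof.
case: b.
  by rewrite (_ : [set _ | _] = setT) //; apply/seteqP; split.
by rewrite (_ : [set _ | _] = set0) //; apply/seteqP; split.
Qed.

Lemma measurable_preimage_count (U : countType) (f : Omega -> U) (D : set U) :
  (forall u, measurable [set w | f w = u]) -> measurable (f @^-1` D).
Proof.
(* The second set is either everything or empty; it selects the values in [D] while the union runs
   over all of [U]. *)
move=> mf; have -> : f @^-1` D =
    \bigcup_u ([set w | f w = u] `&` [set _ | `[< D u >]]).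
  apply/seteqP; split=> [w Dw|w [u _ [/= -> /asboolP//]]].
  by exists (f w) => //; split => //; exact/asboolP.
apply: countable_bigcupT_measurable; first exact: countableP.
by move=> u; apply: measurableI; [exact: mf|exact: measurable_bool_set].
Qed.

Lemma measure_bigcup_count0 (U : countType) (F : U -> set Omega) :
  (forall u, measurable (F u)) -> (forall u, P (F u) = 0%E) ->
  P (\bigcup_u F u) = 0%E.
Proof.
move=> mF F0; apply/negligibleP.
  by apply: countable_bigcupT_measurable; first exact: countableP.
pose G k := if choice.unpickle k is Some u then F u else set0.
apply: (@negligibleS _ _ _ _ (\bigcup_k G k)).
  by move=> w [u _ Fw]; exists (choice.pickle u) => //; rewrite /G choice.pickleK.
apply: negligible_bigcup => k; rewrite /G; case: choice.unpickle => [u|].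
  by apply/(negligibleP _ (mF u)); exact: F0.
exact: negligible_set0.
Qed.

Context (I : finType) (Y : nat -> Omega -> I) (p : I -> R).
Hypothesis mY : forall j (q : pred I), measurable [set w | q (Y j w)].
(** The form in which independence and identical distribution enter this section. *)
Hypothesis matchesP : forall t (s : seq (pred I)),
  P [set w | matches (Y^~ w) t s] = (\prod_(q <- s) P [set w | q (Y 0%N w)])%E.
Hypothesis letterP : forall a, P [set w | Y 0%N w == a] = (p a)%:E.
Hypothesis p_gt0 : forall a, 0 < p a.

Lemma letter_le1 a : p a <= 1.
Proof. by rewrite -lee_fin -letterP; apply/probability_le1/(mY _ (pred1 a)). Qed.

Lemma letter_neqP a : P [set w | Y 0%N w != a] = (1 - p a)%:E.
Proof.
have -> : [set w | Y 0%N w != a] = ~` [set w | Y 0%N w == a].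
  by apply/seteqP; split=> w /= /negP.
by rewrite probability_setC ?letterP //; exact: (mY _ (pred1 a)).
Qed.

Lemma measurable_matches t s : measurable [set w | matches (Y^~ w) t s].
Proof.
elim: s t => [|q s IH] t; first exact: measurable_bool_set true.
have -> : [set w | matches (Y^~ w) t (q :: s)] =
    [set w | q (Y t w)] `&` [set w | matches (Y^~ w) t.+1 s].
  by apply/seteqP; split=> w /andP.
by apply: measurableI; [exact: mY|exact: IH].
Qed.

Definition never (ta : nat * I) : set Omega :=
  [set w | forall s, Y (ta.1 + s)%N w != ta.2].

Lemma measurable_never ta : measurable (never ta).
Proof.
have -> : never ta = \bigcap_s [set w | Y (ta.1 + s)%N w != ta.2].
  by apply/seteqP; split=> w nw s => [_|]; exact: nw.
by apply: bigcapT_measurable => s; exact: (mY _ (predC1 ta.2)).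
Qed.

Lemma prod_avoid a k :
  (\prod_(q <- nseq k (predC1 a : pred I)) P [set w | q (Y 0%N w)] =
   ((1 - p a) ^+ k)%:E)%E.
Proof.
elim: k => [|k IH]; first by rewrite big_nil.
by rewrite big_cons IH letter_neqP -EFinM exprS.
Qed.

(** Never seeing [a] implies avoiding it [m] times in a row, an event of probability
    [(1 - p a) ^+ m], which tends to 0. *)
Lemma never_null ta : P (never ta) = 0%E.
Proof.
case: ta => t a; apply/eqP; rewrite eq_le measure_ge0 andbT.
have le m : (P (never (t, a)) <= ((1 - p a) ^+ m)%:E)%E.
  rewrite -prod_avoid -(matchesP t); apply: le_measure.
  - by rewrite inE; exact: measurable_never.
  - by rewrite inE; exact: measurable_matches.
  - move=> w nw /=; elim: m t nw => //= m IH t nw.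
    rewrite -{1}(addn0 t) nw /=; apply: IH => s.
    by rewrite /= addSn -addnS nw.
have x_fin : P (never (t, a)) \is a fin_num.
  by apply: fin_num_measure; exact: measurable_never.
rewrite -(fineK x_fin) lee_fin.
have z1 : `|1 - p a| < 1.
  by rewrite ger0_norm ?subr_ge0 ?letter_le1 // gtrBl.
have /(cvg_lim (@Rhausdorff R)) <- := cvg_expr z1; apply: limr_ge.
  by apply/cvg_ex; exists 0; exact: cvg_expr.
by apply: nearW => m; rewrite -lee_fin fineK.
Qed.

Definition nonrecurrent : set Omega := \bigcup_ta never ta.

Lemma measurable_nonrecurrent : measurable nonrecurrent.
Proof.
apply: countable_bigcupT_measurable; first exact: countableP.
exact: measurable_never.
Qed.

Lemma nonrecurrent_null : P nonrecurrent = 0%E.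
Proof.
by apply: measure_bigcup_count0; [exact: measurable_never|exact: never_null].
Qed.

Lemma recurrent_off w : ~ nonrecurrent w -> recurrent (Y^~ w).
Proof.
move=> nw t a; apply: contrapT => /forallNP na; apply: nw.
by exists (t, a) => // s; apply/negP; exact: na.
Qed.

Lemma measurable_waiting t a k : measurable [set w | waiting (Y^~ w) t a = k].
Proof.
have [->|k0] := posnP k.
  rewrite (_ : [set w | _] = set0) //; apply/seteqP; split=> w //= w0.
  by have := waiting_gt0 (Y^~ w) t a; rewrite w0.
(* Where [a] does not occur again, [waiting] has its default value 1, so that set contributes only
   for [k = 1]. *)
have -> : [set w | waiting (Y^~ w) t a = k] =
    ([set w | matches (Y^~ w) t (first_at a k)] `&` ~` never (t, a)) `|`
    (never (t, a) `&` [set _ | k == 1%N]).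
  have occurs w : ~ never (t, a) w -> exists s, Y (t + s)%N w == a.
    by move=> nw; apply: contrapT => /forallNP na; apply: nw => s; exact/negP/na.
  have default w : never (t, a) w -> waiting (Y^~ w) t a = 1%N.
    move=> nw; rewrite /waiting; case: pselect => // h; exfalso.
    by case: h => s; apply/negP; exact: nw.
  apply/seteqP; split=> [w /= wk|w /= [[wm /occurs h]|[/default -> /eqP//]]].
    have [nw|nw] := pselect (never (t, a) w).
      by right; split => //; rewrite -wk default.
    left; split => //; rewrite -waiting_matches ?wk //; exact: occurs.
  by apply/eqP; rewrite waiting_matches.
apply: measurableU; apply: measurableI.
- exact: measurable_matches.
- by apply: measurableC; exact: measurable_never.
- exact: measurable_never.
- exact: measurable_bool_set.
Qed.

Lemma measurable_waits t c ks : measurable [set w | waits (Y^~ w) t c = ks].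
Proof.
elim: c t ks => [|a c IH] t [|k ks] /=.
- by rewrite (_ : [set w | _] = setT) //; apply/seteqP; split.
- by rewrite (_ : [set w | _] = set0) //; apply/seteqP; split.
- by rewrite (_ : [set w | _] = set0) //; apply/seteqP; split.
rewrite (_ : [set w | _] = [set w | waiting (Y^~ w) t a = k] `&`
    [set w | waits (Y^~ w) (t + k) c = ks]).
  by apply: measurableI; [exact: measurable_waiting|exact: IH].
by apply/seteqP; split=> w /= [-> ->].
Qed.

Definition geometric_pmf (a : I) (k : nat) : R :=
  if k is k'.+1 then (1 - p a) ^+ k' * p a else 0.

Lemma geometric_pmf_ge0 a k : 0 <= geometric_pmf a k.
Proof.
case: k => //= k; rewrite mulr_ge0 ?exprn_ge0 ?subr_ge0 ?letter_le1 //.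
exact: ltW.
Qed.

Lemma geometric_pmf_sum a : (\sum_(k <oo) (geometric_pmf a k)%:E = 1)%E.
Proof.
(* The term at 0 vanishes; after a shift this is the geometric series with first term [p a] and
   ratio [1 - p a]. *)
apply/cvg_lim => //; rewrite -cvg_shiftS /=.
have z1 : `|1 - p a| < 1.
  by rewrite ger0_norm ?subr_ge0 ?letter_le1 // gtrBl.
have := @cvg_geometric_series R (p a) _ z1; rewrite subKr divff ?gt_eqF // => h.
rewrite (_ : (fun _ => _) = EFin \o series (geometric (p a) (1 - p a))).
  by apply: cvg_EFin => //; exact: nearW.
apply/funext => n /=; rewrite sumEFin big_nat_recl //= add0r /series /=.
by congr EFin; apply: eq_bigr => i _; rewrite mulrC.
Qed.

Lemma prod_first_at a k :
  (\prod_(q <- first_at a k.+1) P [set w | q (Y 0%N w)] =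
   (geometric_pmf a k.+1)%:E)%E.
Proof.
by rewrite /first_at -cats1 big_cat big_seq1 /= prod_avoid letterP -EFinM.
Qed.

Context (c : seq I) (c_uniq : uniq c) (c_full : forall a, a \in c).

(** The waits indexed by the awaited letter rather than by its position in [c]. *)
Definition wait (a : I) (w : Omega) : nat :=
  nth 0%N (waits (Y^~ w) 0 c) (index a c).

Lemma wait_gt0 a w : (0 < wait a w)%N.
Proof.
by apply: (allP (waits_gt0 (Y^~ w) 0 c)); rewrite mem_nth // size_waits index_mem.
Qed.

Lemma measurable_wait a (B : set nat) : measurable (wait a @^-1` B).
Proof.
by apply: (@measurable_preimage_count _ (fun w => waits (Y^~ w) 0 c)
  [set ks | B (nth 0%N ks (index a c))]) => ks; exact: measurable_waits.
Qed.

Lemma waits_wait w : waits (Y^~ w) 0 c = [seq wait a w | a <- c].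
Proof.
case E : c => [//|a0 c']; rewrite -E.
apply: (@eq_from_nth _ 0%N); rewrite size_waits ?size_map // => i ic.
by rewrite (nth_map a0) // /wait index_uniq.
Qed.

Lemma sum_wait w : (\sum_a wait a w)%N = sumn (waits (Y^~ w) 0 c).
Proof.
rewrite waits_wait sumnE big_map [RHS]big_uniq //.
by apply: eq_bigl => a; rewrite c_full.
Qed.

(** On recurrent paths the event is a cylinder event, and each block of its pattern contributes one
    geometric factor. *)
Lemma wait_joint_pmf (k : I -> nat) :
  P [set w | forall a, wait a w = k a] = (\prod_a geometric_pmf a (k a))%:E.
Proof.
(* If some prescribed wait is 0, both sides vanish. *)
have [k0|] := boolP (all (leq 1) [seq k a | a <- c]); last first.
  case/allPn => _ /mapP[a _ ->]; rewrite -eqn0Ngt => /eqP ka0.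
  rewrite (bigD1 a) //= ka0 mul0r (_ : [set w | _] = set0) ?measure0 //.
  apply/seteqP; split=> w //= /(_ a) wa.
  by have := wait_gt0 a w; rewrite wa ka0.
have waitE : [set w | forall a, wait a w = k a] =
    [set w | waits (Y^~ w) 0 c = [seq k a | a <- c]].
  apply/seteqP; split=> w /= wk; rewrite waits_wait in wk *.
    by apply: eq_map.
  by move=> a; have /eq_in_map/(_ a (c_full a)) := wk.
rewrite waitE (@measure_eq_off_null _ _ _ P _
  [set w | matches (Y^~ w) 0 (waits_pattern c [seq k a | a <- c])] nonrecurrent).
- rewrite matchesP /waits_pattern -{1}(map_id c) zip_map -map_comp.
  rewrite big_flatten big_map -prodEFin [RHS](eq_bigl (mem c)); last first.
    by move=> a; rewrite /= c_full.
  rewrite -[RHS]big_uniq //= [LHS]big_seq [RHS]big_seq; apply: eq_bigr => a ac.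
  have := allP k0 (k a) (map_f k ac).
  by case: (k a) => // m _; exact: prod_first_at.
- exact: measurable_waits.
- exact: measurable_matches.
- exact: measurable_nonrecurrent.
- exact: nonrecurrent_null.
- move=> w /recurrent_off wrec /=.
  by rewrite -waits_matches ?size_map //; split=> /eqP.
Qed.

End IIDLetters.

(** * Patterns by position, and infima of sets of naturals *)

Lemma matches_nth (T : eqType) (y : nat -> T) t (s : seq (pred T)) :
  matches y t s <->
  (forall i, (i < size s)%N -> nth xpredT s i (y (t + i)%N)).
Proof.
elim: s t => [|q s IH] t //=; split.
  by move=> /andP[qt /IH h] [|i] /= is_; rewrite ?addn0 // addnS -addSn h.
move=> h; have := h 0%N isT; rewrite addn0 /= => ->; apply/IH => i is_.
by rewrite addSn -addnS; exact: (h i.+1).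
Qed.

Lemma ereal_inf_nat (R : realType) (D : set nat) m :
  D m -> (forall j, D j -> (m <= j)%N) ->
  ereal_inf [set (j%:R)%:E | j in D] = (m%:R)%:E :> \bar R.
Proof.
move=> Dm mD; apply/eqP; rewrite eq_le; apply/andP; split.
  by apply: ereal_inf_lbound; exists m.
by apply/ereal_infP => _ [j Dj <-]; rewrite lee_fin ler_nat mD.
Qed.

Lemma measurable_ereal_inf_nat d (Omega : measurableType d) (R : realType)
    (A : nat -> set Omega) : (forall j, measurable (A j)) ->
  measurable_fun setT
    (fun w => ereal_inf [set (j%:R)%:E | j in [set j | A j w]] : \bar R).
Proof.
move=> mA.
(* The infimum factors through a natural-valued code: 0 for the empty set, whose infimum is
   infinite, and [m.+1] for the minimum [m]. *)
pose S w := if pselect (exists j, `[< A j w >]) is left h then (ex_minn h).+1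
  else 0%N.
pose h k : \bar R := if k is j.+1 then (j%:R)%:E else +oo%E.
have -> : (fun w => ereal_inf [set (j%:R)%:E | j in [set j | A j w]]) = h \o S.
  apply/funext => w; rewrite /h /S /=; case: pselect => [e|ne].
    case: ex_minnP => m /asboolP Am mmin; apply: ereal_inf_nat => // j Aj.
    by apply: mmin; exact/asboolP.
  rewrite (_ : [set j | A j w] = set0) ?image_set0 ?ereal_inf0 //.
  by apply/seteqP; split=> // j Aj; apply: ne; exists j; exact/asboolP.
have mnone m : measurable [set w | forall i, (i < m)%N -> ~ A i w].
  rewrite (_ : [set w | _] = \bigcap_(i in [set i | (i < m)%N]) ~` A i).
    by apply: bigcap_measurableType => i _; exact: measurableC.
  by apply/seteqP; split=> w hw i im; exact: hw.
apply: measurableT_comp => // _ B _; rewrite setTI.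
apply: measurable_preimage_count => -[|m].
  rewrite (_ : [set w | _] = \bigcap_i ~` A i).
    by apply: bigcapT_measurable => i; exact: measurableC.
  apply/seteqP; split=> w; rewrite /S /=; case: pselect => //.
    by move=> ne _ i _ Ai; apply: ne; exists i; exact/asboolP.
  by move=> e /= nA; have [i /asboolP Ai] := e; have := nA i I.
rewrite (_ : [set w | _] = A m `&` [set w | forall i, (i < m)%N -> ~ A i w]).
  exact: measurableI.
apply/seteqP; split=> w; rewrite /S /=; case: pselect => //.
- move=> e; case: ex_minnP => k /asboolP Ak kmin [<-]; split => // i ik Ai.
  by have := kmin i (asboolT Ai); rewrite leqNgt ik.
- move=> e [Am mmin]; case: ex_minnP => k /asboolP Ak kmin.
  apply/eqP; rewrite eqSS eqn_leq kmin ?asboolT //= leqNgt; apply/negP => km.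
  exact: mmin km Ak.
- by move=> ne [Am _]; exfalso; apply: ne; exists m; exact/asboolP.
Qed.

(** * The random walk and its hitting time *)

Section KiselmanWalk.
Context (R : realType) (n : nat) d (Omega : measurableType d).
Context (P : probability Omega R) (X : nat -> {RV P >-> kiselman n}).
Context (Y : nat -> Omega -> 'I_n).
Hypothesis XY : forall j w, X j w = kiselman_gen (Y j w).

(** Since [kiselman_gen] is injective, these sets express events about letters as events about the
    steps [X j]. *)
Let genset (q : pred 'I_n) : set (kiselman n) := [set kiselman_gen i | i in q].

Let gensetE j (q : pred 'I_n) w : genset q (X j w) <-> q (Y j w).
Proof.
rewrite XY; split; last by exists (Y j w).
by case=> i qi /kiselman_gen_inj <-.
Qed.

Let YE j (q : pred 'I_n) : [set w | q (Y j w)] = X j @^-1` genset q.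
Proof. by apply/seteqP; split=> w /gensetE. Qed.

Lemma measurable_letter j (q : pred 'I_n) : measurable [set w | q (Y j w)].
Proof. by rewrite YE; apply: measurable_funPTI. Qed.

Lemma iid_matches (X_indep : mutually_independent X)
    (X_id : identically_distributed X) t (s : seq (pred 'I_n)) :
  P [set w | matches (Y^~ w) t s] = (\prod_(q <- s) P [set w | q (Y 0%N w)])%E.
Proof.
pose J := [fset j in iota t (size s)]%fset.
(* The difference [j - t] is the position of time [j] in the window starting at [t]. *)
pose B j := genset (nth xpredT s (j - t)).
have -> : [set w | matches (Y^~ w) t s] = \bigcap_(j in [set` J]) (X j @^-1` B j).
  apply/seteqP; split=> w /= => [/matches_nth h j|h].
    rewrite /= !inE mem_iota => /andP[tj js]; apply/gensetE.
    by have := h (j - t)%N; rewrite subnKC // ltn_subLR //; apply.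
  apply/matches_nth => i is_.
  have := h (t + i)%N; rewrite /= !inE mem_iota leq_addr ltn_add2l is_.
  by move=> /(_ isT) /gensetE; rewrite addKn.
rewrite X_indep //.
under eq_bigr => j _ do rewrite [P _](X_id j 0%N) // /distribution /pushforward -YE.
rewrite (perm_big (iota t (size s))) /=; last first.
  by apply: uniq_perm; rewrite ?fset_uniq ?iota_uniq // => j; rewrite !inE.
rewrite -{1}[t]addn0 iotaDl big_map.
rewrite [RHS](big_nth xpredT) /index_iota subn0.
by apply: eq_bigr => i _; rewrite addKn.
Qed.

Lemma kiselman_walkE j w :
  kiselman_walk X j w = kiselman_class [seq Y i w | i <- iota 0 j].
Proof.
rewrite -prod_kiselman_gen big_map /kiselman_walk.
rewrite -(big_mkord xpredT (fun k => X k w)) /index_iota subn0.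
by apply: eq_bigr => i _; rewrite XY.
Qed.

(** The walk is at the zero element at time [j] exactly when the greedy search has ended by then,
    that is, when the waits sum to at most [j]. *)
Lemma hitting_timeE w : recurrent (Y^~ w) ->
  hitting_time X R w =
  ((sumn (waits (Y^~ w) 0 (descending_letters n)))%:R)%:E.
Proof.
move=> wrec.
have zeroP j : kiselman_walk X j w = kiselman_zero n <->
    (sumn (waits (Y^~ w) 0 (descending_letters n)) <= j)%N.
  rewrite -read_waits // kiselman_walkE.
  by split=> [/class_zeroP/eqP|/eqP/class_zeroP].
by apply: ereal_inf_nat => [|j]; rewrite /= zeroP.
Qed.

Lemma measurable_hitting_time : measurable_fun setT (hitting_time X R).
Proof.
apply: (@measurable_ereal_inf_nat _ _ R
  (fun j => [set w | kiselman_walk X j w = kiselman_zero n])) => j.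
(* The walk at time [j] depends on the word of the first [j] letters, which has countably many
   values, each attained on a cylinder event or nowhere. *)
rewrite (_ : [set w | _] = (fun w => [seq Y i w | i <- iota 0 j]) @^-1`
  [set u | kiselman_class u = kiselman_zero n]).
  apply: measurable_preimage_count => u.
  have [us|us] := eqVneq (size u) j; last first.
    rewrite (_ : [set w | _] = set0) //; apply/seteqP; split=> w //= wu.
    by move: us; rewrite -wu size_map size_iota eqxx.
  rewrite (_ : [set w | _] =
    [set w | matches (Y^~ w) 0 [seq (pred1 i : pred 'I_n) | i <- u]]).
    exact: measurable_matches measurable_letter _ _.
  rewrite -{}us; elim: u 0%N => [|i u IH] t; first by apply/seteqP; split.
  have /seteqP[h1 h2] := IH t.+1; apply/seteqP; split=> w /=.
    by case=> <- wu; rewrite eqxx; exact: h1.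
  by move=> /andP[/eqP -> wu]; congr (_ :: _); exact: h2.
by apply/seteqP; split=> w /=; rewrite kiselman_walkE.
Qed.

End KiselmanWalk.

(** * The distribution of the hitting time *)

Theorem theorem6p6 (R : realType) (n : nat) (n_gt1 : (1 < n)%N)
    (d : measure_display) (Omega : measurableType d) (P : probability Omega R)
    (X : nat -> {RV P >-> kiselman n})
    (X_gen : forall j w, exists i : 'I_n, X j w = kiselman_gen i)
    (X_indep : mutually_independent X)
    (X_id : identically_distributed X)
    (p : 'I_n -> R)
    (pE : forall i, P [set w | X 0%N w = kiselman_gen i] = (p i)%:E)
    (p_gt0 : forall i, 0 < p i) :
  let T : Omega -> \bar R := @hitting_time n Omega X R in
  measurable_fun [set: Omega] T /\
  exists (d' : measure_display) (Omega' : measurableType d')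
         (Q : probability Omega' R) (V : 'I_n -> {RV Q >-> nat}),
    [/\ mutually_independent V,
        forall i, geometric_RV (V i) (p i) &
        forall B : set (\bar R), measurable B ->
          P (T @^-1` B) =
          Q ((fun w => ((\sum_(i < n) V i w)%N%:R)%:E) @^-1` B)].
Proof.
move=> T.
have /choice[Y XY] : forall j, exists y : Omega -> 'I_n,
    forall w, X j w = kiselman_gen (y w).
  by move=> j; have [y yE] := choice (X_gen j); exists y.
have mT : measurable_fun setT T := measurable_hitting_time XY.
split=> //.
pose c := descending_letters n.
have c_uniq : uniq c := descending_letters_uniq n.
have c_full a : a \in c := mem_descending_letters a.
have mY := measurable_letter XY.
have matchesP := iid_matches XY X_indep X_id.
have letterP a : P [set w | Y 0%N w == a] = (p a)%:E.
  rewrite -pE; congr (P _); apply/seteqP; split=> w /=; rewrite XY.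
    by move/eqP=> ->.
  by move/kiselman_gen_inj=> ->.
have mW a (B : set nat) := measurable_wait mY c a B.
have W_law := wait_joint_pmf mY matchesP letterP p_gt0 c_uniq c_full.
have g_ge0 := geometric_pmf_ge0 mY letterP p_gt0.
have g_sum := geometric_pmf_sum mY letterP p_gt0.
have mWf a : measurable_fun setT (wait Y c a) by move=> _ B _; rewrite setTI.
pose V a : {RV P >-> nat} :=
  HB.pack (wait Y c a) (isMeasurableFun.Build _ _ _ _ _ (mWf a)).
exists d, Omega, P, V; split.
- exact: (joint_pmf_independent mW g_ge0 g_sum W_law).
- move=> a; split=> [w|[//|k] _]; first exact: wait_gt0.
  rewrite (_ : [set w | _] = wait Y c a @^-1` [set k.+1]) //.
  by rewrite (marginal_law mW g_ge0 g_sum W_law) (law_of_set1 g_ge0).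
(* The two variables agree on recurrent paths. Elsewhere [T] may be infinite while the sum of waits
   is finite, but those paths form a null set. *)
- move=> B mB; apply: (measure_eq_off_null _ _ (measurable_nonrecurrent mY)).
  + by rewrite -[X in measurable X]setTI; exact: mT.
  + rewrite (_ : _ @^-1` B = (fun w => waits (Y^~ w) 0 c) @^-1`
      [set ks | B ((sumn ks)%:R)%:E]).
      by apply: measurable_preimage_count => ks; exact: measurable_waits.
    by apply/seteqP; split=> w /=; rewrite sum_wait.
  + exact: (nonrecurrent_null mY matchesP letterP p_gt0).
  + move=> w /recurrent_off wrec.
    by rewrite /= /T (hitting_timeE XY wrec) sum_wait.
Qed.
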